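(* Let $G$ be a graph and $\theta$ a real number. Let $H_1,\dots,H_q$ be the components of $G\setminus A_\theta(G)$ that are $\theta$-critical and $Q_1,\dots,Q_m$ the components of $G\setminus A_\theta(G)$ with $\mathrm{mult}(\theta,Q_j)=0$. Let $u,v$ be distinct vertices and suppose one of the following holds: (a) $u\in V(G)\setminus A_\theta(G)$ and $v\in V(Q_{j_0})$ for some $j_0$; (b) $u,v\in V(H_{i_0})$ for some $i_0$; (c) $\mathrm{mult}(\theta,G)\ge 2$, $u\in V(H_{i_1})$ and $v\in V(H_{i_2})$ with $i_1\neq i_2$. Then $A_\theta(G)$ is a $\theta$-extreme set in $S_\theta(G)\setminus\{u,v\}$, i.e. $\mathrm{mult}(\theta,S_\theta(G)\setminus(A_\theta(G)\cup\{u,v\}))=\mathrm{mult}(\theta,S_\theta(G)\setminus\{u,v\})+|A_\theta(G)|$.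
   Context: All graphs are finite and simple. For a graph $G$ on $n$ vertices, let $p(G,r)$ be the number of $r$-matchings of $G$ ($p(G,0)=1$); the matching polynomial is $\mu(G,x)=\sum_{r=0}^{\lfloor n/2\rfloor}(-1)^r p(G,r)x^{n-2r}$. For real $\theta$, $\mathrm{mult}(\theta,G)$ is the multiplicity of $\theta$ as a root of $\mu(G,x)$ (it is $0$ if $\theta$ is not a root). $G\setminus X$ denotes deletion of the vertex set $X$; $G\setminus u=G\setminus\{u\}$. A vertex $u$ is $\theta$-essential, $\theta$-neutral, or $\theta$-positive in $G$ according as $\mathrm{mult}(\theta,G\setminus u)$ equals $\mathrm{mult}(\theta,G)-1$, $\mathrm{mult}(\theta,G)$, or $\mathrm{mult}(\theta,G)+1$. A vertex is $\theta$-special if it is not $\theta$-essential but is adjacent to a $\theta$-essential vertex; $A_\theta(G)$ is the set of $\theta$-special vertices. A connected graph is $\theta$-critical if all its vertices are $\theta$-essential in it. Every component of $G\setminus A_\theta(G)$ is either $\theta$-critical or has $\mathrm{mult}(\theta,\cdot)=0$. $S_\theta(G)$ is the graph on $V(G)$ whose edges are the edges of $G$ together with all pairs $\{w,z\}$, $z\neq w$, with $w\in A_\theta(G)$. A set $X$ is $\theta$-extreme in a graph $F$ if $\mathrm{mult}(\theta,F\setminus X)=\mathrm{mult}(\theta,F)+|X|$. *)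

(* Defs.v *)
(* A finite simple graph is a symmetric irreflexive
   relation [e : rel T] on a finite type [T] (vertex set = T).
   All graph operations are done on induced subgraphs G[S], S : {set T};
   deletion G \ X is G[~: X]. *)
From HB Require Import structures.
From mathcomp Require Import all_boot all_order all_algebra.
Set Implicit Arguments.
Unset Strict Implicit.
Unset Printing Implicit Defensive.
Import Order.TTheory GRing.Theory Num.Theory.

Section Graphs.
Variable T : finType.

Definition edge_in (e : rel T) (S : {set T}) (E : {set T}) : bool :=
  [exists x, exists y, [&& x \in S, y \in S, e x y & E == [set x; y]]].

Definition is_matching (e : rel T) (S : {set T}) (M : {set {set T}}) : bool :=
  [forall E in M, edge_in e S E] &&
  [forall E1 in M, forall E2 in M, (E1 != E2) ==> [disjoint E1 & E2]].

Definition nmatch (e : rel T) (S : {set T}) (r : nat) : nat :=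
  #|[set M : {set {set T}} | is_matching e S M & #|M| == r]|.

Definition matchpoly (R : nzRingType) (e : rel T) (S : {set T}) : {poly R} :=
  \sum_(r < (#|S|./2).+1)
     (((-1) ^+ r * (nmatch e S r)%:R) *: 'X^(#|S| - r.*2)).

Definition mult (R : fieldType) (theta : R) (e : rel T) (S : {set T}) : nat :=
  mup theta (matchpoly R e S).

Definition essential (R : fieldType) (theta : R) (e : rel T) (S : {set T})
  (w : T) : bool :=
  (mult theta e (S :\ w)).+1 == mult theta e S.

Definition rel_in (e : rel T) (S : {set T}) : rel T :=
  [rel x y | [&& x \in S, y \in S & e x y]].

Definition component (e : rel T) (S : {set T}) (u : T) : {set T} :=
  [set v | (v \in S) && connect (rel_in e S) u v].

Definition connected_in (e : rel T) (S : {set T}) : bool :=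
  (S != set0) && [forall x in S, forall y in S, connect (rel_in e S) x y].

Definition critical (R : fieldType) (theta : R) (e : rel T) (S : {set T}) : bool :=
  connected_in e S && [forall w in S, essential theta e S w].

Definition Aset (R : fieldType) (theta : R) (e : rel T) : {set T} :=
  [set w | ~~ essential theta e setT w &&
           [exists z, essential theta e setT z && e w z]].

Definition Srel (R : fieldType) (theta : R) (e : rel T) : rel T :=
  [rel x y | e x y ||
     ((x != y) && ((x \in Aset theta e) || (y \in Aset theta e)))].

End Graphs.

(* Main.v *)
(* Write mu(S) for the matching polynomial of G[S].  A vertex joined to all of
   Y satisfies mu(Y + a) = X mu(Y) - mu(Y)', so it lowers the multiplicity of
   theta by one as long as theta is a root; the theorem thus amounts to
   mult(G \ A \ {u, v}) >= |A|.  This follows, component by component, from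
   mult(G \ A) = mult(G) + |A| and from Gallai's lemma (theta-critical graphs
   have multiplicity one).  Both rest on the fact that
     mu(S \ u) mu(S \ v) - mu(S) mu(S \ u \ v)
   is a sum of squares, hence of even order at theta with positive leading
   coefficient.  Since this remains true after adding 1 to the weight of a third
   vertex w, parity also constrains the multiplicities of the graphs obtained by
   deleting subsets of {u, v, w}. *)
Require Import Defs.
From HB Require Import structures.
From mathcomp Require Import all_boot all_order all_algebra.
From mathcomp Require Import ring zify.
Set Implicit Arguments.
Unset Strict Implicit.
Unset Printing Implicit Defensive.
Import Order.TTheory GRing.Theory Num.Theory.
Local Open Scope ring_scope.

Lemma setD1C (T : finType) (S : {set T}) (x y : T) : S :\ x :\ y = S :\ y :\ x.
Proof. by rewrite !setDDl setUC. Qed.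

(** * Matchings of induced subgraphs and the vertex recursion *)

Section Matchings.
Variables (T : finType) (e : rel T).
Hypothesis (e_sym : symmetric e) (e_irr : irreflexive e).
Implicit Types (S E : {set T}) (M : {set {set T}}) (u z : T).

Lemma edge_inP S E :
  reflect (exists x y, [/\ x \in S, y \in S, e x y & E = [set x; y]])
          (edge_in e S E).
Proof.
apply: (iffP existsP) => [[x /existsP[y /and4P[? ? ? /eqP ?]]]|[x [y [? ? ? ?]]]].
  by exists x, y.
by exists x; apply/existsP; exists y; apply/and4P; split=> //; apply/eqP.
Qed.

Lemma edge_in_at S E u : edge_in e S E -> u \in E ->
  exists z, [/\ z \in S :\ u, e u z & E = [set u; z]].
Proof.
case/edge_inP=> x [y [xS yS exy ->]]; rewrite !inE => /orP[]/eqP->.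
  exists y; split=> //; rewrite !inE yS andbT.
  by apply: contraTneq exy => ->; rewrite e_irr.
exists x; split; [|by rewrite e_sym|by rewrite setUC].
by rewrite !inE xS andbT; apply: contraTneq exy => ->; rewrite e_irr.
Qed.

Lemma edge_in_sub S E : edge_in e S E -> E \subset S.
Proof.
case/edge_inP=> x [y [xS yS _ ->]]; apply/subsetP=> t.
by rewrite !inE => /orP[]/eqP->.
Qed.

Lemma card_edge_in S E : edge_in e S E -> #|E| = 2%N.
Proof.
case/edge_inP=> x [y [_ _ exy ->]]; rewrite cards2.
by case: eqP exy => // ->; rewrite e_irr.
Qed.

Lemma edge_inW S S' E : edge_in e S E -> S \subset S' -> edge_in e S' E.
Proof.
case/edge_inP=> x [y [xS yS exy ->]] /subsetP sSS'; apply/edge_inP.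
by exists x, y; split=> //; apply: sSS'.
Qed.

Lemma edge_inI S S' E : edge_in e S E -> E \subset S' -> edge_in e S' E.
Proof.
case/edge_inP=> x [y [xS yS exy ->]] /subsetP sSS'; apply/edge_inP.
by exists x, y; split=> //; apply: sSS'; rewrite !inE eqxx ?orbT.
Qed.

Lemma is_matchingP S M :
  reflect ({in M, forall E, edge_in e S E} /\ trivIset M) (is_matching e S M).
Proof.
apply: (iffP andP) => [[/forall_inP edgeM trivM]|[edgeM trivM]].
  split=> //; apply/trivIsetP=> A B AM BM.
  by move/forall_inP/(_ A AM)/forall_inP/(_ B BM)/implyP: trivM; apply.
split; first exact/forall_inP.
apply/forall_inP=> A AM; apply/forall_inP=> B BM; apply/implyP.
by move/trivIsetP: trivM; apply.
Qed.

Lemma matching_cover_sub S M : is_matching e S M -> cover M \subset S.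
Proof.
case/is_matchingP=> edgeM _; apply/bigcupsP=> E /edgeM; exact: edge_in_sub.
Qed.

Lemma card_matching_cover S M : is_matching e S M -> #|cover M| = #|M|.*2.
Proof.
case/is_matchingP=> edgeM /eqP<-; rewrite -muln2 -sum_nat_const.
by apply: eq_bigr => E /edgeM /card_edge_in.
Qed.

Lemma matching_le S M : is_matching e S M -> (#|M|.*2 <= #|S|)%N.
Proof.
move=> mM; rewrite -(card_matching_cover mM).
exact/subset_leq_card/matching_cover_sub.
Qed.

Lemma matching_D1 S M u :
  is_matching e (S :\ u) M = is_matching e S M && (u \notin cover M).
Proof.
apply/idP/andP => [mM|[/is_matchingP[edgeM trivM] uM]].
  split; last first.
    apply/negP=> uM; have := subsetP (matching_cover_sub mM) u uM.
    by rewrite !inE eqxx.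
  case/is_matchingP: mM => edgeM trivM; apply/is_matchingP; split=> // E /edgeM.
  by move/edge_inW; apply; apply: subD1set.
apply/is_matchingP; split=> // E EM; apply: (edge_inI (edgeM _ EM)).
rewrite subsetD1 (edge_in_sub (edgeM _ EM)) /=.
by apply: contra uM => uE; apply/bigcupP; exists E.
Qed.

Lemma matching_edgeD1 S M u z : [set u; z] \in M -> is_matching e S M ->
  is_matching e (S :\ u :\ z) (M :\ [set u; z]).
Proof.
set E0 := [set u; z] => E0M /is_matchingP[edgeM trivM].
apply/is_matchingP; split; last exact: trivIsetS (subD1set _ _) trivM.
move=> E; rewrite in_setD1 => /andP[neE EM].
apply: (edge_inI (edgeM _ EM)); rewrite !subsetD1 (edge_in_sub (edgeM _ EM)) /=.
move/trivIsetP: trivM => /(_ E E0 EM E0M neE).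
rewrite disjoint_sym => /disjointFr dis.
by rewrite !dis // !inE eqxx ?orbT.
Qed.

Lemma matching_edgeU1 S M u z : u \in S -> z \in S :\ u -> e u z ->
  is_matching e (S :\ u :\ z) M ->
  is_matching e S ([set u; z] |: M) /\ [set u; z] \notin M.
Proof.
set E0 := [set u; z] => uS; rewrite !inE => /andP[zu zS] euz mM.
have covM := matching_cover_sub mM.
case/is_matchingP: (mM) => edgeM trivM.
have disE0 : [disjoint E0 & cover M].
  apply/pred0P=> t; rewrite !inE; apply/negP=> /andP[tE0 /(subsetP covM)].
  by rewrite !inE; case/orP: tE0 => /eqP->; rewrite eqxx ?andbF.
split; last first.
  apply/negP=> E0M; have : u \in cover M.
    by apply/bigcupP; exists E0 => //; rewrite !inE eqxx.
  by rewrite (disjointFr disE0) // !inE eqxx.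
apply/is_matchingP; split.
  move=> E; rewrite !inE => /orP[/eqP->|/edgeM /edge_inW].
    by apply/edge_inP; exists u, z.
  by apply; rewrite !setDDl subsetDl.
apply: trivIsetU => //; last by rewrite cover1.
by apply/trivIsetP => A B; rewrite !inE => /eqP-> /eqP->; rewrite eqxx.
Qed.

Section Poly.
Variable R : comNzRingType.

(** Indexing by matchings rather than by their size turns the vertex recursion into a bijection
    between matchings. *)
Lemma matchpolyE S : matchpoly R e S =
  \sum_(M | is_matching e S M) (-1) ^+ #|M| *: 'X^(#|S| - #|M|.*2).
Proof.
rewrite /matchpoly.
have lt_r M : is_matching e S M -> (#|M| < (#|S|./2).+1)%N.
  by move/matching_le; rewrite ltnS => h; rewrite -(half_bit_double #|M| false) half_leq.
rewrite (partition_big (fun M => inord #|M| : 'I_(#|S|./2).+1) xpredT) //=.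
apply: eq_bigr => r _.
rewrite (eq_bigr (fun=> (-1) ^+ r *: 'X^(#|S| - r.*2))); last first.
  by move=> M /andP[mM /eqP <-]; rewrite inordK ?lt_r.
rewrite sumr_const -scaler_nat scalerA mulr_natl mulr_natr; congr (_ *+ _ *: _).
apply: eq_card => M; rewrite !inE; apply: andb_id2l => mM.
by rewrite -val_eqE /= inordK ?lt_r.
Qed.

Lemma matchpoly0 : matchpoly R e set0 = 1.
Proof.
rewrite matchpolyE (big_pred1 set0) ?cards0 ?expr0 ?scale1r // => M /=.
apply/idP/eqP => [/matching_le|->].
  by rewrite cards0 leqn0 double_eq0 cards_eq0 => /eqP.
apply/is_matchingP; split=> [E|]; first by rewrite inE.
by apply/trivIsetP=> A B; rewrite inE.
Qed.

(** Matchings that miss [u] give the first term; any other contains exactly one edge [[set u; z]],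
    whose removal costs a sign and two vertices. *)
Lemma matchpoly_rec S u : u \in S -> matchpoly R e S =
  'X * matchpoly R e (S :\ u) -
  \sum_(z in S :\ u | e u z) matchpoly R e (S :\ u :\ z).
Proof.
move=> uS; rewrite matchpolyE (bigID (fun M : {set {set T}} => u \notin cover M)) /=.
congr (_ + _).
  rewrite matchpolyE mulr_sumr; apply: eq_big => [M|M /andP[mM uM]].
    by rewrite matching_D1.
  have {}mM : is_matching e (S :\ u) M by rewrite matching_D1 mM.
  have := matching_le mM; rewrite (cardsD1 u S) uS => leM.
  by rewrite -scalerAr -exprS -subSn.
rewrite -sumrN.
(* For a given [M] the inner sum has one term if [M] covers [u] and none otherwise, so the two sums
   can be exchanged. *)
transitivity (\sum_(M | is_matching e S M)
    \sum_(z in S :\ u | e u z && ([set u; z] \in M))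
      (-1) ^+ #|M| *: 'X^(#|S| - #|M|.*2) : {poly R}).
  rewrite big_mkcondr; apply: eq_bigr => M mM; rewrite negbK.
  case/is_matchingP: (mM) => edgeM trivM.
  case: ifP => [/bigcupP[E EM uE]|uM]; last first.
    rewrite big1 // => z /and3P[_ _ uzM]; case/negP: (negbT uM).
    by apply/bigcupP; exists [set u; z]; rewrite ?inE ?eqxx.
  have [z [zS euz defE]] := edge_in_at (edgeM _ EM) uE.
  rewrite (big_pred1 z) // => t /=; apply/and3P/eqP => [[tS eut utM]|->]; last first.
    by rewrite -defE.
  have : [set u; t] = [set u; z].
    apply/eqP; apply: contraT => ne.
    have := (trivIsetP trivM) _ _ utM EM; rewrite defE.
    move=> /(_ ne)/disjointFr/(_ (set21 _ _)).
    by rewrite !inE eqxx.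
  move/setP/(_ t); rewrite !inE eqxx orbT => /esym/orP[/eqP tu|/eqP//].
  by move: tS; rewrite tu !inE eqxx.
rewrite (exchange_big_dep (fun z => (z \in S :\ u) && e u z)) /=; last first.
  by move=> M z _ /and3P[-> ->].
apply: eq_bigr => z /andP[zS euz]; set E0 := [set u; z].
rewrite matchpolyE -sumrN.
rewrite (reindex_onto (fun M => E0 |: M) (fun M => M :\ E0)) /=; last first.
  by move=> M /and4P[_ _ _]; exact: setD1K.
have mE M : [&& is_matching e S (E0 |: M), (z \in S :\ u), e u z & E0 \in E0 |: M]
      && ((E0 |: M) :\ E0 == M) = is_matching e (S :\ u :\ z) M.
  apply/andP/idP => [[/and4P[mM _ _ E0M] /eqP eqM]|mM].
    by rewrite -eqM; exact: matching_edgeD1.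
  have [mM' E0M] := matching_edgeU1 uS zS euz mM.
  by rewrite mM' zS euz setU11 setU1K.
apply: eq_big => [M|M]; rewrite mE // => mM.
have [mM' E0M] := matching_edgeU1 uS zS euz mM.
rewrite cardsU1 E0M add1n exprS mulN1r scaleNr doubleS.
by rewrite (cardsD1 u S) uS (cardsD1 z (S :\ u)) zS.
Qed.
End Poly.
End Matchings.

(** * Order and leading coefficient of a polynomial at [theta] *)

Section LocalOrder.
Variables (R : realFieldType) (theta : R).
Implicit Types (p q : {poly R}) (a b : R) (m n : nat).

Local Notation Xt := ('X - theta%:P).

(* [p] has order at least [m] at [theta], and its coefficient at
   ['X - theta] to the power [m] is [a], possibly zero. *)
Definition olc m a p := exists2 q, p = q * Xt ^+ m & q.[theta] = a.

Lemma olc0 m : olc m 0 0.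
Proof. by exists 0; rewrite ?mul0r ?horner0. Qed.

Lemma olcD m a b p q : olc m a p -> olc m b q -> olc m (a + b) (p + q).
Proof.
by move=> [r -> <-] [s -> <-]; exists (r + s); rewrite ?hornerD // mulrDl.
Qed.

Lemma olcN m a p : olc m a p -> olc m (- a) (- p).
Proof. by move=> [r -> <-]; exists (- r); rewrite ?hornerN // mulNr. Qed.

Lemma olcB m a b p q : olc m a p -> olc m b q -> olc m (a - b) (p - q).
Proof. by move=> hp hq; apply: olcD => //; apply: olcN. Qed.

Lemma olcM m n a b p q : olc m a p -> olc n b q -> olc (m + n) (a * b) (p * q).
Proof.
by move=> [r -> <-] [s -> <-]; exists (r * s); rewrite ?hornerM // mulrACA exprD.
Qed.

Lemma olc_lt m n a p : (n < m)%N -> olc m a p -> olc n 0 p.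
Proof.
move=> ltnm [r -> _]; exists (r * Xt ^+ (m - n)); last first.
  rewrite hornerM horner_exp !hornerE subrr expr0n subn_eq0 leqNgt ltnm.
  by rewrite mulr0.
by rewrite -mulrA -exprD subnK // ltnW.
Qed.

Lemma olc_inj m a b p : olc m a p -> olc m b p -> a = b.
Proof.
move=> [r -> <-] [s eqrs <-]; congr (_.[_]).
by apply: mulIf eqrs; rewrite expf_neq0 // polyXsubC_eq0.
Qed.

Lemma mup_olc p : p != 0 -> exists2 a : R, a != 0 & olc (mup theta p) a p.
Proof.
move=> p0; have [m [q]] := multiplicity_XsubC p theta; rewrite p0 /= => qN0 ->.
exists q.[theta]; first exact: qN0.
by exists q; rewrite // mupMr // mup_XsubCX eqxx.
Qed.

Lemma olc_mup m a p : a != 0 -> olc m a p -> mup theta p = m.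
Proof.
by move=> a0 [q -> qa]; rewrite mupMr ?mup_XsubCX ?eqxx // /root qa.
Qed.

Lemma olc_wronskian m n a b p q : olc m.+1 a p -> olc n b q ->
  olc (m + n) ((m.+1%:R - n%:R) * (a * b)) (p^`() * q - p * q^`()).
Proof.
move=> [r -> <-] [s -> <-].
exists (m.+1%:R *: (r * s) - n%:R *: (r * s) + Xt * (r^`() * s - r * s^`())).
  rewrite !derivM !deriv_exp !derivXsubC !mul1r -!scaler_nat exprD exprS /=.
  (* For [n = 0] the truncated exponent [n.-1] is harmless, as its term carries the factor [n]. *)
  case: n => [|n]; rewrite /= ?exprS ?scale0r; first by rewrite -!mul_polyC; ring.
  by rewrite -!mul_polyC; ring.
by rewrite !(hornerD, hornerN, hornerZ, hornerM, hornerX, hornerC) subrr; ring.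
Qed.

(* The local form of being a sum of squares. *)
Definition evpos p := p = 0 \/ exists m, exists2 a, 0 < a & olc m.*2 a p.

Lemma evpos0 : evpos 0. Proof. by left. Qed.

(** The summand of lower order dominates; at equal orders two positive coefficients cannot
    cancel. *)
Lemma evposD p q : evpos p -> evpos q -> evpos (p + q).
Proof.
case=> [->|[m [a a0 pa]]]; first by rewrite add0r.
case=> [->|[n [b b0 qb]]]; first by rewrite addr0; right; exists m, a.
right; case: (ltngtP m n) => [mn|nm|eqmn].
- exists m, (a + 0); first by rewrite addr0.
  by apply: olcD => //; apply: olc_lt qb; rewrite ltn_double.
- exists n, (0 + b); first by rewrite add0r.
  by apply: olcD => //; apply: olc_lt pa; rewrite ltn_double.
exists m, (a + b); first exact: addr_gt0.
by apply: olcD => //; rewrite eqmn.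
Qed.

Lemma evpos_sqr p : evpos (p * p).
Proof.
have [->|/mup_olc[a a0 pa]] := eqVneq p 0; first by rewrite mul0r; left.
right; exists (mup theta p), (a * a); first by rewrite -expr2 exprn_even_gt0.
by rewrite -addnn; apply: olcM.
Qed.

Lemma evpos_sum (I : finType) (P : pred I) (F : I -> {poly R}) :
  (forall i, P i -> evpos (F i)) -> evpos (\sum_(i | P i) F i).
Proof. by move=> FP; apply: big_ind => //; [exact: evpos0|exact: evposD]. Qed.

Lemma evpos_olc m a p : evpos p -> olc m a p -> 0 <= a /\ (odd m -> a = 0).
Proof.
case=> [->|[n [b b0 pb]]] pa; first by rewrite (olc_inj pa (olc0 m)).
case: (ltngtP m n.*2) => [mn|nm|eqmn].
- by rewrite (olc_inj pa (olc_lt mn pb)).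
- by rewrite (olc_inj pb (olc_lt nm pa)) ltxx in b0.
rewrite eqmn in pa *; rewrite (olc_inj pa pb) odd_double; split=> //.
exact: ltW.
Qed.

Lemma evpos_odd m a p : evpos p -> olc m a p -> odd m -> a != 0 -> False.
Proof. by move=> hp /(evpos_olc hp)[_ h] /h->; rewrite eqxx. Qed.
End LocalOrder.

(** * Vertex-weighted matching recursions and an identity of Christoffel-Darboux type *)

Section WeightedRecursion.
Variables (R : realFieldType) (theta : R) (T : finType) (e : rel T).
Implicit Types (S : {set T}) (u v w z : T) (F : {set T} -> {poly R}).

(** The matching recursion with vertex weights [y]; constant weight ['X] gives [mu]. It is kept
    abstract so that the sum of squares survives a change of weight. *)
Definition mrec (y : T -> {poly R}) F := forall S u, u \in S ->
  F S = y u * F (S :\ u) - \sum_(z in S :\ u | e u z) F (S :\ u :\ z).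

Definition delta F S u v := F (S :\ u) * F (S :\ v) - F S * F (S :\ u :\ v).

(** Expand [F S] and [F (S :\ v)] at [u]: the weight terms cancel, the neighbour [z = v] yields the
    square, and every other [z] yields a [delta] on [S :\ u]. *)
Lemma delta_rec y F S u v : mrec y F -> u \in S -> v \in S -> u != v ->
  delta F S u v =
    (if e u v then F (S :\ u :\ v) * F (S :\ u :\ v) else 0) +
    \sum_(z in S :\ u :\ v | e u z) delta F (S :\ u) z v.
Proof.
move=> Frec uS vS uv; rewrite /delta.
have uSv : u \in S :\ v by rewrite !inE uv.
have vSu : v \in S :\ u by rewrite !inE eq_sym uv.
rewrite (Frec S u uS) (Frec (S :\ v) u uSv) (setD1C S v u).
rewrite sumrB -mulr_sumr -mulr_suml.
rewrite [X in _ - (_ - X) * _](_ : _ = (if e u v then F (S :\ u :\ v) else 0) +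
   \sum_(z in S :\ u :\ v | e u z) F (S :\ u :\ z)); last first.
  rewrite big_mkcondr (big_setD1 v) //=; congr (_ + _).
  by rewrite -big_mkcondr.
rewrite (eq_bigr (fun z => F (S :\ u :\ z :\ v))); last first.
  by move=> z _; rewrite setD1C.
case: ifP => _; ring.
Qed.

(** Iterating [delta_rec] writes [delta] as the sum, over the paths from [u] to [v], of the square
    of [F] on the complement of the path. *)
Lemma evpos_delta y F S u v : mrec y F -> u \in S -> v \in S -> u != v ->
  evpos theta (delta F S u v).
Proof.
move=> Frec; elim: {S}_.+1 {-2}S (ltnSn #|S|) u v => // n IHn S leS u v uS vS uv.
rewrite (delta_rec Frec) //; apply: evposD.
  by case: ifP => _; [exact: evpos_sqr|exact: evpos0].
apply: evpos_sum => z /andP[]; rewrite !inE => /and3P[zv zu zS] _.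
apply: IHn; rewrite ?inE ?zu // ?(eq_sym v) ?uv //.
by move: leS; rewrite (cardsD1 u S) uS ltnS.
Qed.

(* By multi-affinity, this is [F] with the weight of [w] increased by one. *)
Definition shift_weight F w S := F S + (if w \in S then F (S :\ w) else 0).

(** At [w] itself the extra term is absorbed by the new weight. At another [u] the recursions of
    [F S] and [F (S :\ w)] add up, the second having no term for [z = w]. *)
Lemma mrec_shift y F w : mrec y F ->
  mrec (fun u => if u == w then y u + 1 else y u) (shift_weight F w).
Proof.
move=> Frec S u uS; rewrite /shift_weight /=.
have [eq_uw|uw] := eqVneq u w.
  rewrite {}eq_uw in uS *; rewrite uS setD11 (Frec _ _ uS) addr0.
  rewrite [in RHS](eq_bigr (fun z => F (S :\ w :\ z))).
    by ring.
  by move=> z _; rewrite !inE eqxx andbF addr0.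
rewrite big_split /= (Frec _ _ uS) !inE (eq_sym w u) uw /=.
case: ifP => wS; last first.
  rewrite [X in _ - (_ + X)]big1 ?addr0 // => z _.
  by rewrite !inE wS !andbF.
rewrite (Frec (S :\ w) u) ?inE ?uw // (setD1C S w u).
rewrite [X in _ = _ - (_ + X)](_ : _ =
  \sum_(z in S :\ u :\ w | e u z) F (S :\ u :\ w :\ z)); last first.
  rewrite big_mkcondr [RHS]big_mkcondr (big_setD1 w) ?inE ?(eq_sym w) ?uw //=.
  rewrite eqxx if_same add0r; apply: eq_bigr => z; rewrite !inE => /and3P[zw zu zS].
  by rewrite (eq_sym w z) zw (eq_sym w u) uw wS setD1C.
by ring.
Qed.
End WeightedRecursion.

(* [lia] splits on every boolean hypothesis, hence the clearing. *)
Ltac mult_lia :=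
  repeat match goal with H : is_true _ |- _ => clear H end;
  repeat match goal with |- context [mult ?t ?e ?S] => move: (mult t e S) => ? end;
  lia.

(** * Interlacing of multiplicities, types of vertices and stability *)

Section Multiplicity.
Variables (R : realFieldType) (theta : R) (T : finType) (e : rel T).
Hypothesis (e_sym : symmetric e) (e_irr : irreflexive e).
Implicit Types (S C D : {set T}) (u v w z : T).

Local Notation mu := (matchpoly R e).
Local Notation m := (mult theta e).

Let mu_rec : mrec e (fun=> 'X) mu.
Proof. by move=> S u; exact: matchpoly_rec. Qed.

Lemma set_card_ind (P : {set T} -> Prop) :
  (forall S, (forall S', (#|S'| < #|S|)%N -> P S') -> P S) -> forall S, P S.
Proof.
move=> IH S; elim: {S}_.+1 {-2}S (ltnSn #|S|) => // n IHn S leS.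
by apply: IH => S' ltS; apply: IHn; apply: leq_trans ltS _.
Qed.

Lemma card_setD1_lt S u : u \in S -> (#|S :\ u| < #|S|)%N.
Proof. by move=> uS; rewrite [X in (_ < X)%N](cardsD1 u) uS. Qed.

Lemma size_matchpoly S : size (mu S) = #|S|.+1.
Proof.
elim/set_card_ind: S => S IH; have [->|[u uS]] := set_0Vmem S.
  by rewrite matchpoly0 // size_polyC oner_eq0 cards0.
have ltS := card_setD1_lt uS.
have szX : size ('X * mu (S :\ u)) = #|S|.+1.
  rewrite mulrC size_mulX ?IH //; first by rewrite (cardsD1 u S) uS.
  by rewrite -size_poly_eq0 IH.
rewrite (mu_rec uS) size_polyDl ?szX // size_polyN ltnS.
apply: leq_trans (size_sum _ _ _) _; apply/bigmax_leqP => z /andP[zS _].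
have ltSz := card_setD1_lt zS.
by rewrite IH; [exact: leq_trans ltSz (ltnW ltS)|exact: ltn_trans ltS].
Qed.

Lemma matchpoly_neq0 S : mu S != 0.
Proof. by rewrite -size_poly_eq0 size_matchpoly. Qed.

Lemma deriv_matchpoly S : (mu S)^`() = \sum_(u in S) mu (S :\ u).
Proof.
elim/set_card_ind: S => S IH; have [->|[a aS]] := set_0Vmem S.
  by rewrite matchpoly0 // derivC big_set0.
have ltS := card_setD1_lt aS.
rewrite (mu_rec aS) (big_setD1 a) //= derivB derivM derivX mul1r IH //.
rewrite -addrA; congr (_ + _).
rewrite [RHS](eq_bigr (fun u => 'X * mu (S :\ a :\ u) -
    \sum_(z in S :\ a :\ u | e a z) mu (S :\ a :\ u :\ z))); last first.
  move=> u; rewrite !inE => /andP[ua uS].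
  by rewrite (@mu_rec _ a) ?inE ?aS ?(eq_sym a) ?ua // (setD1C S u a).
rewrite sumrB mulr_sumr; congr (_ - _); rewrite raddf_sum /=.
rewrite [RHS](exchange_big_dep (fun z => (z \in S :\ a) && e a z)) /=; last first.
  by move=> u z _ /andP[]; rewrite !inE => /and3P[_ -> ->] ->.
apply: eq_bigr => z /andP[zS eaz].
rewrite IH; last exact: ltn_trans (card_setD1_lt zS) ltS.
apply: eq_big => [u|u _]; last by rewrite setD1C.
by move: zS; rewrite !inE eaz (eq_sym u z) => /andP[-> ->]; rewrite !andbT andbC.
Qed.

Lemma matchpoly_disjoint C D : [disjoint C & D] ->
  (forall x y, x \in C -> y \in D -> ~~ e x y) ->
  mu (C :|: D) = mu C * mu D.
Proof.
elim/set_card_ind: C => C IH disCD noedge; have [->|[u uC]] := set_0Vmem C.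
  by rewrite matchpoly0 // set0U mul1r.
have ltC := card_setD1_lt uC.
have IH' C' : (#|C'| < #|C|)%N -> C' \subset C -> mu (C' :|: D) = mu C' * mu D.
  move=> ltC' sC'; apply: IH => //; first exact: disjointWl disCD.
  by move=> x y xC; apply: noedge; apply: (subsetP sC').
have delU C' x : x \in C -> (C' :|: D) :\ x = C' :\ x :|: D.
  move=> xC; apply/setP => t; rewrite !inE; case: eqP => //= ->.
  by rewrite (disjointFr disCD).
rewrite (@mu_rec (C :|: D) u) ?inE ?uC // (mu_rec uC) mulrBl -mulrA delU //.
rewrite IH' ?subD1set //; congr (_ - _); rewrite mulr_suml.
apply: eq_big => [z|z /andP[]]; rewrite !inE.
  case: (boolP (z \in D)) => [zD|]; last by rewrite orbF.
  by rewrite (negbTE (noedge _ _ uC zD)) !andbF.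
case/orP=> [/andP[zu zC] _|zD /(negP (noedge _ _ uC zD))//].
rewrite delU // IH' //; last by rewrite setDDl subsetDl.
by apply: ltn_trans ltC; apply: card_setD1_lt; rewrite !inE zu.
Qed.

Lemma mult_disjoint C D : [disjoint C & D] ->
  (forall x y, x \in C -> y \in D -> ~~ e x y) ->
  m (C :|: D) = (m C + m D)%N.
Proof.
by move=> dis noedge; rewrite /mult matchpoly_disjoint // mupM ?matchpoly_neq0.
Qed.

Lemma mult_olc S : exists2 a : R, a != 0 & olc theta (m S) a (mu S).
Proof. exact/mup_olc/matchpoly_neq0. Qed.

(** Both derivatives are sums over deleted vertices; [v = u] occurs only in the first and
    contributes the square. *)
Lemma wronskian_matchpoly S u : u \in S ->
  (mu S)^`() * mu (S :\ u) - mu S * (mu (S :\ u))^`() =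
  mu (S :\ u) * mu (S :\ u) + \sum_(v in S :\ u) delta mu S u v.
Proof.
move=> uS; rewrite !deriv_matchpoly (big_setD1 u) //= /delta sumrB.
by rewrite -!mulr_sumr; ring.
Qed.

Lemma evpos_delta_mu S u v : u \in S -> v \in S -> u != v ->
  evpos theta (delta mu S u v).
Proof. exact: evpos_delta mu_rec. Qed.

Lemma evpos_sum_delta S u : u \in S ->
  evpos theta (\sum_(v in S :\ u) delta mu S u v).
Proof.
move=> uS; apply: evpos_sum => v; rewrite !inE => /andP[vu vS].
by apply: evpos_delta_mu; rewrite // eq_sym.
Qed.

(** Otherwise the square in the wronskian identity has lower order than the wronskian, and the sum
    of the [delta] would start with a negative coefficient. *)
Lemma mult_del_ge S u : u \in S -> (m S <= (m (S :\ u)).+1)%N.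
Proof.
move=> uS; rewrite leqNgt; apply/negP => lt_m.
have [a a0 fa] := mult_olc S; have [b b0 gb] := mult_olc (S :\ u).
case: (m S) lt_m fa => // k lt_m fa.
have := olc_wronskian fa gb; rewrite wronskian_matchpoly // => W.
have lt2 : (m (S :\ u) + m (S :\ u) < k + m (S :\ u))%N by rewrite ltn_add2r -ltnS.
have := olcB (olc_lt lt2 W) (olcM gb gb); rewrite addrAC subrr !add0r => {}W.
by have [] := evpos_olc (evpos_sum_delta uS) W;
  rewrite oppr_ge0 leNgt -expr2 exprn_even_gt0 // b0.
Qed.

(** By [mult_del_ge] every term of the recursion at [u] has order at least [m (S :\ u) - 1]. *)
Lemma mult_del_le S u : u \in S -> (m (S :\ u) <= (m S).+1)%N.
Proof.
move=> uS; case E: (m (S :\ u)) => [//|k]; rewrite ltnS /mult mup_geq ?matchpoly_neq0 //.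
have dvd n S' : (n <= m S')%N -> ('X - theta%:P) ^+ n %| mu S'.
  by rewrite /mult mup_geq ?matchpoly_neq0.
rewrite (mu_rec uS) dvdp_sub ?dvdp_mull ?dvd ?E //.
apply: (big_ind (fun p => ('X - theta%:P) ^+ k %| p)) => [|p q|z /andP[zS _]].
- exact: dvdp0.
- exact: dvdp_add.
by apply: dvd; have := mult_del_ge zS; rewrite E ltnS.
Qed.

(* The wronskian makes all the residues of [mu (S \ u \ z) / mu (S \ u)] at
   [theta] nonnegative, so that no cancellation occurs in [mu_rec]. *)
Lemma essential_nbr S u v : u \in S -> v \in S :\ u -> e u v ->
  essential theta e (S :\ u) v -> (m S).+1 = m (S :\ u).
Proof.
move=> uS vS euv /eqP; set n := m (S :\ u :\ v) => mE.
have [a a0 fa] := mult_olc (S :\ u); rewrite -mE in fa *; congr _.+1.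
have sgn z : z \in S :\ u -> exists c,
    [/\ olc theta n c (mu (S :\ u :\ z)), 0 <= a * c & (m (S :\ u :\ z) = n -> c != 0)].
  move=> zS; have [c c0 fc] := mult_olc (S :\ u :\ z).
  have := mult_del_ge zS; rewrite -mE ltnS leq_eqVlt => /predU1P[eqn|ltn].
    rewrite -eqn in fc; exists c; split=> //.
    have := olc_wronskian fa fc; rewrite -natrB // subSnn mul1r.
    rewrite wronskian_matchpoly // => W.
    by case: (evpos_olc (evposD (evpos_sqr _ _) (evpos_sum_delta zS)) W).
  by exists 0; rewrite mulr0; split=> // [|eqn]; [exact: olc_lt fc|lia].
have Q : exists2 c, olc theta n c (\sum_(z in S :\ u | e u z) mu (S :\ u :\ z))
    & 0 < a * c.
  rewrite (bigD1 v) /= ?vS //.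
  have [c [fc ac nc]] := sgn v vS.
  have [d fd ad] : exists2 d, olc theta n d
     (\sum_(z | ((z \in S :\ u) && e u z) && (z != v)) mu (S :\ u :\ z)) & 0 <= a * d.
    apply: (big_ind (fun p => exists2 d, olc theta n d p & 0 <= a * d))
      => [|p q [d pd ad] [d' pd' ad']|z /andP[/andP[zS _] _]].
    - by exists 0; [exact: olc0|rewrite mulr0].
    - by exists (d + d'); [exact: olcD|rewrite mulrDr addr_ge0].
    - by have [d [? ? _]] := sgn z zS; exists d.
  exists (c + d); first exact: olcD.
  by rewrite mulrDr ltr_wpDr // lt_def ac mulf_neq0 ?nc.
case: Q => c fc ac; rewrite /mult (mu_rec uS).
have fX : olc theta 0 theta 'X by exists 'X; rewrite ?mulr1 ?hornerX.
apply: olc_mup (olcB (olc_lt _ (olcM fX fa)) fc); last exact: ltnSn.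
by rewrite sub0r oppr_eq0; apply: contraTneq ac => ->; rewrite mulr0 ltxx.
Qed.

(** When the two products in [delta] have different orders they cannot cancel, so the smaller order
    is that of [delta]. *)
Lemma delta_parity S u v : u \in S -> v \in S -> u != v ->
  let a := (m (S :\ u) + m (S :\ v))%N in
  let b := (m S + m (S :\ u :\ v))%N in
  a != b -> ~~ odd (minn a b).
Proof.
move=> uS vS uv a b ab; apply/negP => odd_ab.
have [fu fu0 Fu] := mult_olc (S :\ u); have [fv fv0 Fv] := mult_olc (S :\ v).
have [f f0 F] := mult_olc S; have [fuv fuv0 Fuv] := mult_olc (S :\ u :\ v).
have Fa := olcM Fu Fv; have Fb := olcM F Fuv; rewrite -/a -/b in Fa Fb.
have D := evpos_delta_mu uS vS uv.
case: ltngtP ab odd_ab => // [lt_ab|lt_ba] _ odd_ab.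
  by apply: (evpos_odd D (olcB Fa (olc_lt lt_ab Fb))); rewrite // subr0 mulf_neq0.
by apply: (evpos_odd D (olcB (olc_lt lt_ba Fa) Fb)); rewrite // sub0r oppr_eq0 mulf_neq0.
Qed.

(** With [k = m S], interlacing leaves [k - 1] or [k] for [m (S :\ u :\ v)]; the value [k] would
    give [delta] the odd order [2k - 1]. *)
Lemma neutral_essential S u v : u \in S -> v \in S -> u != v ->
  m (S :\ u) = m S -> essential theta e S v -> essential theta e (S :\ u) v.
Proof.
move=> uS vS uv neu /eqP ess.
have vSu : v \in S :\ u by rewrite !inE eq_sym uv.
have uSv : u \in S :\ v by rewrite !inE uv.
have := delta_parity uS vS uv; rewrite /essential.
have := mult_del_ge vSu; have := mult_del_le uSv; rewrite (setD1C S v u).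
move: neu ess; mult_lia.
Qed.

(** If [u] were neutral, [v] would stay essential in [S :\ u], and [essential_nbr] would make [u]
    positive. *)
Lemma special_positive S u v : u \in S -> v \in S -> e u v ->
  ~~ essential theta e S u -> essential theta e S v -> m (S :\ u) = (m S).+1.
Proof.
move=> uS vS euv ness ess.
have uv : u != v by apply: contraTneq euv => ->; rewrite e_irr.
have vSu : v \in S :\ u by rewrite !inE eq_sym uv.
have [neu|nneu] := eqVneq (m (S :\ u)) (m S).
  have := essential_nbr uS vSu euv (neutral_essential uS vS uv neu ess).
  by rewrite neu => /eqP; rewrite -{2}[m S]addn0 -addn1 eqn_add2l.
move: ness nneu; have := mult_del_ge uS; have := mult_del_le uS; rewrite /essential.
mult_lia.
Qed.

Lemma positive_essential S u v : u \in S -> v \in S -> u != v ->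
  m (S :\ u) = (m S).+1 -> essential theta e S v -> essential theta e (S :\ u) v.
Proof.
move=> uS vS uv pos /eqP ess; rewrite /essential.
have vSu : v \in S :\ u by rewrite !inE eq_sym uv.
have uSv : u \in S :\ v by rewrite !inE uv.
have := mult_del_ge vSu; have := mult_del_le uSv; rewrite (setD1C S v u).
move: pos ess; mult_lia.
Qed.

(* Give [w] the weight [X + 1]: then [delta] has even order at [theta], but
   under these hypotheses the cross term [mu (S \ w) * mu (S \ u \ v)] would be
   its unique term of lowest order. *)
Lemma delta_shift_parity S u v w : u \in S -> v \in S -> w \in S ->
  u != v -> u != w -> v != w ->
  let N := (m (S :\ w) + m (S :\ u :\ v))%N in
  odd N ->
  (N < m (S :\ u) + m (S :\ v))%N ->
  (N < m (S :\ u) + m (S :\ v :\ w))%N ->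
  (N < m (S :\ u :\ w) + m (S :\ v))%N ->
  (N < m (S :\ u :\ w) + m (S :\ v :\ w))%N ->
  (N < m S + m (S :\ u :\ v))%N ->
  (N < m S + m (S :\ u :\ v :\ w))%N ->
  (N < m (S :\ w) + m (S :\ u :\ v :\ w))%N -> False.
Proof.
move=> uS vS wS uv uw vw N oddN h1 h2 h3 h4 h5 h6 h7.
have D : evpos theta (delta (shift_weight mu w) S u v).
  exact: evpos_delta (mrec_shift w mu_rec) uS vS uv.
move: D; rewrite /delta /shift_weight !inE wS (eq_sym w) uw (eq_sym w) vw /=.
set p := (X in evpos _ X) => D.
have prod a b : (N < m a + m b)%N -> olc theta N 0 (mu a * mu b).
  have [x _ X] := mult_olc a; have [y _ Y] := mult_olc b.
  by move/olc_lt; apply; apply: olcM X Y.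
have [x x0 X] := mult_olc (S :\ w); have [y y0 Y] := mult_olc (S :\ u :\ v).
have P := olcD (olcB (olcB (olcB (olcD (olcD (olcD (prod _ _ h1) (prod _ _ h2))
  (prod _ _ h3)) (prod _ _ h4)) (prod _ _ h5)) (prod _ _ h6)) (prod _ _ h7))
  (olcN (olcM X Y)).
apply: (@evpos_odd _ theta N (- (x * y)) p D _ oddN); last by rewrite oppr_eq0 mulf_neq0.
suff -> : p = mu (S :\ u) * mu (S :\ v) + mu (S :\ u) * mu (S :\ v :\ w)
  + mu (S :\ u :\ w) * mu (S :\ v) + mu (S :\ u :\ w) * mu (S :\ v :\ w)
  - mu S * mu (S :\ u :\ v) - mu S * mu (S :\ u :\ v :\ w)
  - mu (S :\ w) * mu (S :\ u :\ v :\ w) + - (mu (S :\ w) * mu (S :\ u :\ v)).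
  by move: P; rewrite !addr0 !subr0 add0r.
by rewrite /p; ring.
Qed.

(** If [v] became essential, the multiplicities after deleting any subset of [u], [v], [w] would all
    be forced. With [k = m S], the cross term [mu (S :\ w) * mu (S :\ u :\ v)] would then have odd
    order [2k - 1], below all other terms. *)
Lemma stability S u v w : u \in S -> v \in S -> w \in S -> e u w -> u != v ->
  ~~ essential theta e S u -> essential theta e S w ->
  ~~ essential theta e S v -> ~~ essential theta e (S :\ u) v.
Proof.
move=> uS vS wS euw uv nessu essw nessv; apply/negP => essv.
have uw : u != w by apply: contraTneq euw => ->; rewrite e_irr.
have vw : v != w by apply: contraNneq nessv => ->.
have posu := special_positive uS wS euw nessu essw.
have /eqP essw' := positive_essential uS wS uw posu essw.
have uSv : u \in S :\ v by rewrite !inE uv.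
have wSv : w \in S :\ v by rewrite !inE eq_sym vw.
have uSw : u \in S :\ w by rewrite !inE uw.
have vSw : v \in S :\ w by rewrite !inE vw.
have wSuv : w \in S :\ u :\ v by rewrite !inE !(eq_sym w) uw vw.
have wSvu : w \in S :\ v :\ u by rewrite setD1C.
(* Otherwise [essential_nbr] at [u] in [S :\ v] would make [v] essential in [S]. *)
have nw : ~~ essential theta e (S :\ u :\ v) w.
  apply/negP; rewrite (setD1C S u v) => /(essential_nbr uSv wSvu euw).
  move/eqP: essv; rewrite (setD1C S v u) posu => [[->]] h.
  by case/negP: nessv; rewrite /essential h.
(* Were [v] neutral, [w] would stay essential in [S :\ v] and [u] would be positive there, which
   contradicts [essv]. *)
have nneu : m (S :\ v) != m S.
  apply/eqP => neu; have essw2 := neutral_essential vS wS vw neu essw.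
  have nessu2 : ~~ essential theta e (S :\ v) u.
    by move/eqP: essv; rewrite /essential (setD1C S v u) posu neu => [[->]]; mult_lia.
  have := special_positive uSv wSv euw nessu2 essw2.
  by move/eqP: essv; rewrite (setD1C S v u) posu neu => [[->]]; mult_lia.
have posv : m (S :\ v) = (m S).+1.
  move: nneu nessv; have := mult_del_ge vS; have := mult_del_le vS.
  rewrite /essential; mult_lia.
have xvw : m (S :\ v :\ w) = m S.
  have := mult_del_le vSw; have := mult_del_ge wSv; rewrite (setD1C S w v).
  by move: posv essw; rewrite /essential; mult_lia.
have xuv : m (S :\ u :\ v) = m S.
  by move: essv posu; rewrite /essential; mult_lia.
have xuw : m (S :\ u :\ w) = m S by move: essw' posu; mult_lia.
(* By [nw] only [k] and [k + 1] remain; for [k], the products of [delta] in [S :\ w] would have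
   orders [2k] and [2k - 1], against parity. *)
have xuvw : m (S :\ u :\ v :\ w) = (m S).+1.
  have := delta_parity uSw vSw uv; have := mult_del_le wSuv; have := mult_del_ge wSuv.
  rewrite (setD1C S w u) (setD1C S w v) (setD1C (S :\ u) w v) xuw xvw xuv.
  by move: essw nw; rewrite /essential xuv; mult_lia.
have := @delta_shift_parity S u v w uS vS wS uv uw vw.
rewrite /= xuvw xuw xvw xuv posu posv; move/eqP: essw => <-.
by apply; rewrite ?oddD /=; mult_lia.
Qed.
End Multiplicity.

(** * Deletion of special vertices, Gallai's lemma and joins *)

Section Structure.
Variables (R : realFieldType) (theta : R) (T : finType) (e : rel T).
Hypothesis (e_sym : symmetric e) (e_irr : irreflexive e).
Implicit Types (S C D B Y : {set T}) (u v w z : T).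

Local Notation mu := (matchpoly R e).
Local Notation m := (mult theta e).
Let del_le := mult_del_le theta e_sym e_irr.
Let del_ge := mult_del_ge theta e_sym e_irr.

(** Delete [B] one vertex at a time: each is positive, [stability] keeps the rest of [B]
    nonessential, and [positive_essential] preserves their essential neighbours. *)
Lemma mult_extreme S B : B \subset S ->
  (forall b, b \in B -> ~~ essential theta e S b) ->
  (forall b, b \in B -> exists2 z, z \in S & essential theta e S z && e b z) ->
  m (S :\: B) = (m S + #|B|)%N.
Proof.
elim: {B}_.+1 {-2}B (ltnSn #|B|) S => // n IHn B ltB S sBS nessB nbrB.
have [->|[b bB]] := set_0Vmem B; first by rewrite setD0 cards0 addn0.
have bS := subsetP sBS b bB; have [w wS /andP[essw ebw]] := nbrB b bB.
have pos := special_positive e_sym e_irr bS wS ebw (nessB b bB) essw.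
have defD : S :\: B = S :\ b :\: (B :\ b).
  by rewrite setDDl setD1K.
rewrite defD IHn.
- by rewrite pos [in RHS](cardsD1 b B) bB addnA addn1.
- by move: ltB; rewrite (cardsD1 b B) bB.
- exact: setSD.
- move=> a; rewrite !inE => /andP[ab aB].
  by apply: (stability e_sym e_irr bS (subsetP sBS a aB) wS ebw);
    rewrite ?nessB // eq_sym.
move=> a; rewrite !inE => /andP[ab aB]; have [z zS /andP[essz eaz]] := nbrB a aB.
have bz : b != z by apply: contraTneq essz => <-; apply: nessB.
exists z; first by rewrite !inE eq_sym bz.
by rewrite eaz (positive_essential e_sym e_irr bS zS bz pos essz).
Qed.

(** The derivative of [mu S] has order exactly [m S - 1]; without essential vertices all its
    summands [mu (S :\ z)] would have order at least [m S]. *)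
Lemma exists_essential S : (0 < m S)%N -> exists2 z, z \in S & essential theta e S z.
Proof.
move=> mS; have [a a0 fa] := mult_olc theta e_sym e_irr S.
have [/existsP[z /andP[zS ez]]|/existsPn noess] :=
  boolP [exists z, (z \in S) && essential theta e S z]; first by exists z.
case E: (m S) mS fa => [//|n] _ fa.
have fd : olc theta n (n.+1%:R * a) (mu S)^`().
  have f1 : olc theta 0 1 (1 : {poly R}) by exists 1; rewrite ?mulr1 ?hornerC.
  (* The wronskian with the constant 1 is the derivative. *)
  have := olc_wronskian fa f1.
  by rewrite addn0 derivC mulr0 subr0 !mulr1 subr0.
have f0 : olc theta n 0 (mu S)^`().
  rewrite deriv_matchpoly //; apply: (big_ind (olc theta n 0)) => [|p q pn qn|z zS].
  - exact: olc0.
  - by rewrite -[0]addr0; apply: olcD.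
  have [b _ fb] := mult_olc theta e_sym e_irr (S :\ z).
  apply: olc_lt fb; have := noess z; have := del_ge zS.
  by rewrite zS /essential /= E; mult_lia.
by move/eqP: (olc_inj fd f0); rewrite mulf_eq0 pnatr_eq0 (negbTE a0).
Qed.

(** When all vertices are essential, the inequality for [u], [v] says that [v] is not essential in
    [S :\ u]. If transitivity failed, shifting the weight of the middle vertex [v] would give a
    [delta] of odd order [2k - 3], with [k = m S]. *)
Lemma gallai_trans S u v w : (forall x, x \in S -> essential theta e S x) ->
  u \in S -> v \in S -> w \in S ->
  (m S <= (m (S :\ u :\ v)).+1)%N -> (m S <= (m (S :\ v :\ w)).+1)%N ->
  (m S <= (m (S :\ u :\ w)).+1)%N.
Proof.
move=> ess uS vS wS huv hvw.
have [eq_uv|uv] := eqVneq u v; first by rewrite eq_uv.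
have [eq_wv|vw] := eqVneq v w; first by rewrite -eq_wv.
have [eq_uw|uw] := eqVneq u w.
  by rewrite eq_uw setDDl setUid (eqP (ess w wS)).
rewrite leqNgt; apply/negP => huw.
have [/eqP eu /eqP ev /eqP ew] := And3 (ess u uS) (ess v vS) (ess w wS).
have uSv : u \in S :\ v by rewrite !inE uv.
have wSv : w \in S :\ v by rewrite !inE eq_sym vw.
have wSu : w \in S :\ u by rewrite !inE eq_sym uw.
have vSuw : v \in S :\ u :\ w by rewrite !inE vw eq_sym uv.
have wSuv : w \in S :\ u :\ v by rewrite !inE !(eq_sym w) uw vw.
have xuw : (m (S :\ u :\ w)).+2 = m S.
  by have := del_ge wSu; move: huw eu; mult_lia.
(* The only other value allowed by interlacing, [k - 2], would give [delta] in [S :\ v] the odd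
   order [2k - 3]. *)
have xuvw : (m (S :\ u :\ w :\ v)).+1 = m S.
  have := @delta_parity R theta T e e_sym e_irr _ _ _ uSv wSv uw.
  have := del_le vSuw; have := del_ge wSuv.
  rewrite (setD1C S v u) (setD1C (S :\ u) v w).
  by move: xuw huv hvw ev; mult_lia.
have := @delta_shift_parity R theta T e e_sym e_irr S u w v uS wS vS uw uv.
rewrite eq_sym vw => /(_ isT) /=; rewrite (setD1C S w v).
move: huv hvw; rewrite -xuw in xuvw eu ev ew *; move: xuvw eu ev ew.
move=> [->] [->] [->] [->] huv hvw.
by apply; move: huv hvw; rewrite ?oddD /=; mult_lia.
Qed.

(** Transitivity along paths from [u] shows that no vertex is essential in [S :\ u]. Hence [theta]
    is not a root there, while deleting [u] lowers the multiplicity by one. *)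
Lemma gallai S : critical theta e S -> m S = 1%N.
Proof.
case/andP=> /andP[/set0Pn[u uS] /forall_inP conn] /forall_inP ess.
have all_v v : v \in S -> (m S <= (m (S :\ u :\ v)).+1)%N.
  move=> vS; have /connectP[p] := forall_inP (conn u uS) v vS.
  elim/last_ind: p v vS => [|p x IHp] v vS /=.
    by move=> _ ->; rewrite setDDl setUid (eqP (ess u uS)).
  rewrite rcons_path last_rcons => /andP[pth /and3P[yS xS eyx]] eqv.
  rewrite {v}eqv in vS *; set y := last u p in pth yS eyx.
  apply: (gallai_trans ess uS yS xS); first exact: IHp.
  rewrite leqNgt; apply/negP => lt_m.
  have xy : x \in S :\ y.
    by rewrite !inE xS andbT; apply: contraTneq eyx => ->; rewrite e_irr.
  (* Base of the transitivity: [essential_nbr] would make [y] positive, although [y] is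
     essential. *)
  have : essential theta e (S :\ y) x.
    have := eqP (ess y yS); have := del_ge xy; rewrite /essential.
    by move: lt_m; mult_lia.
  move/(essential_nbr e_sym e_irr yS xy eyx).
  by have := eqP (ess y yS); mult_lia.
have [mu0|/exists_essential[z]] := posnP (m (S :\ u)).
  by rewrite -(eqP (ess u uS)) mu0.
rewrite !inE => /andP[_ zS] /eqP ez; have := all_v z zS.
by have := eqP (ess u uS); move: ez; mult_lia.
Qed.

Lemma mult_cone Y a : a \notin Y -> (forall z, z \in Y -> e a z) ->
  (0 < m Y)%N -> (m (a |: Y)).+1 = m Y.
Proof.
move=> aY joined; have [b b0 fb] := mult_olc theta e_sym e_irr Y.
case E: (m Y) fb => [//|n] fb _; congr _.+1; rewrite /mult.
have fX : olc theta 0 theta 'X by exists 'X; rewrite ?mulr1 ?hornerX.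
have f1 : olc theta 0 1 (1 : {poly R}) by exists 1; rewrite ?mulr1 ?hornerC.
have fd := olc_wronskian fb f1; rewrite addn0 derivC mulr0 subr0 !mulr1 subr0 in fd.
have -> : mu (a |: Y) = 'X * mu Y - (mu Y)^`().
  rewrite (@matchpoly_rec _ _ e_sym e_irr _ _ a) ?setU11 // setU1K // deriv_matchpoly //.
  by congr (_ - _); apply: eq_bigl => z; apply: andb_idr; apply: joined.
apply: (olc_mup _ (olcB (olc_lt _ (olcM fX fb)) fd)); last exact: ltnSn.
by rewrite sub0r oppr_eq0 mulf_neq0 // pnatr_eq0.
Qed.

(** The vertices of [B] are added one by one; the bound on [#|B|] keeps [theta] a root before each
    addition. *)
Lemma mult_join Y B : [disjoint B & Y] ->
  (forall b z, b \in B -> z \in B :|: Y -> b != z -> e b z) ->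
  (#|B| <= m Y)%N -> m Y = (m (B :|: Y) + #|B|)%N.
Proof.
elim: {B}_.+1 {-2}B (ltnSn #|B|) => // n IHn B ltB disBY joined leB.
have [->|[b bB]] := set_0Vmem B; first by rewrite set0U cards0 addn0.
have cB : #|B| = (#|B :\ b|).+1 by rewrite (cardsD1 b B) bB.
have sub : B :\ b \subset B by exact: subD1set.
have IH : m Y = (m (B :\ b :|: Y) + #|B :\ b|)%N.
  apply: IHn; [by rewrite -cB -ltnS|exact: disjointWl disBY| |by rewrite ltnW // -cB].
  move=> a z aB zBY; apply: joined; first exact: (subsetP sub).
  by apply: subsetP zBY; apply: setSU.
have bY : b \notin B :\ b :|: Y by rewrite !inE eqxx /= (disjointFr disBY).
have pos : (0 < m (B :\ b :|: Y))%N by move: leB cB IH; mult_lia.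
have := mult_cone bY _ pos; rewrite setUA setD1K // => cone.
have {}cone : (m (B :|: Y)).+1 = m (B :\ b :|: Y).
  apply: cone => z zB; apply: joined => //; first by apply: subsetP zB; apply: setSU.
  by apply: contraNneq bY => {1}->.
by move: IH cone cB; mult_lia.
Qed.
End Structure.

(** This transfers multiplicities between the graph and [Srel] outside [A], where the edges
    agree. *)
Lemma mult_eq_in (R : fieldType) (theta : R) (T : finType) (e e' : rel T)
  (S : {set T}) : {in S &, e =2 e'} -> mult theta e S = mult theta e' S.
Proof.
move=> eqe; rewrite /mult /matchpoly; congr mup; apply: eq_bigr => r _.
congr (_ * _%:R *: _); apply: eq_card => M; rewrite !inE /is_matching.
congr (_ && _ && _); apply: eq_forallb => E; congr (_ ==> _).
apply: eq_existsb => x; apply: eq_existsb => y.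
by case: (boolP (x \in S)) => // xS; case: (boolP (y \in S)) => // yS; rewrite eqe.
Qed.

(** * Splitting multiplicities along a component *)

Section Components.
Variables (T : finType) (e : rel T).
Hypothesis (e_sym : symmetric e) (e_irr : irreflexive e).

Lemma component_refl (S : {set T}) u : u \in S -> u \in component e S u.
Proof. by move=> uS; rewrite inE uS connect0. Qed.

(** The component is taken in [S] while [X] may be smaller, so that one split serves before and
    after the deletion of [u] and [v]. *)
Lemma mult_component (R : realFieldType) (theta : R) (S X : {set T}) u :
  X \subset S -> mult theta e X =
  (mult theta e (X :&: component e S u) + mult theta e (X :\: component e S u))%N.
Proof.
move=> sXS; rewrite -{1}(setID X (component e S u)) mult_disjoint //.
  apply/pred0P=> x; rewrite /= in_setI in_setD.
  by case: (x \in X); case: (x \in component e S u).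
move=> x y; rewrite !inE => /andP[_ /andP[xS ux]] /andP[nuy yX]; apply: contra nuy => exy.
have yS := subsetP sXS y yX; rewrite yS /=.
have rxy : rel_in e S x y by rewrite /rel_in /= xS yS.
exact: connect_trans ux (connect1 rxy).
Qed.
End Components.

(** * Counting the loss caused by [u] and [v] in each of the three positions *)

Theorem theorem4p7 (R : rcfType) (T : finType) (e : rel T)
  (e_sym : symmetric e) (e_irr : irreflexive e) (theta : R) (u v : T) :
  u != v ->
  let A := Aset theta e in
  let GA := ~: A in
  ((* (a) *)
   (u \notin A /\ v \notin A /\ mult theta e (component e GA v) = 0%N)
   \/
   (* (b) *)
   (u \notin A /\ v \notin A /\ v \in component e GA u /\
    critical theta e (component e GA u))
   \/
   (* (c) *)
   ((2 <= mult theta e setT)%N /\ u \notin A /\ v \notin A /\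
    v \notin component e GA u /\
    critical theta e (component e GA u) /\
    critical theta e (component e GA v))) ->
  mult theta (Srel theta e) (~: (A :|: [set u; v])) =
    (mult theta (Srel theta e) (~: [set u; v]) + #|A|)%N.
Proof.
move=> uv A GA hyp.
have [A0|[a aA]] := set_0Vmem A; first by rewrite A0 set0U cards0 addn0.
(* A special vertex has an essential neighbour, so [theta] is a root; this unit pays for the single
   loss in cases (a) and (b). *)
have ess_pos : (0 < mult theta e setT)%N.
  move: aA; rewrite inE => /andP[_ /existsP[z /andP[/eqP <- _]]].
  exact: ltn0Sn.
have mGA : mult theta e GA = (mult theta e setT + #|A|)%N.
  rewrite -mult_extreme ?subsetT ?setTD // => b; rewrite inE => /andP[] //.
  by move=> _ /existsP[z zP]; exists z.
have [uA vA] : u \notin A /\ v \notin A.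
  by case: hyp => [[? []]|[[? []]|[_ [? []]]]].
set Y := ~: (A :|: [set u; v]).
have YE : Y = GA :\ u :\ v.
  apply/setP => x; rewrite !inE !negb_or.
  by case: (x == u); case: (x == v); rewrite ?andbF ?andbT.
have sYGA : Y \subset GA by rewrite YE setDDl subsetDl.
(* Membership of [x] is not assumed because in case (a) [u] may lie in the component of [v]. *)
have del X x : (mult theta e X <= (mult theta e (X :\ x)).+1)%N.
  have [xX|xX] := boolP (x \in X); first exact: mult_del_ge.
  suff -> : X :\ x = X by exact: leqnSn.
  by apply/setDidPl; rewrite disjoint_sym disjoints1.
have leY : (#|A| <= mult theta e Y)%N.
  case: hyp => [[_ [_ mC0]]|[[_ [_ [vC crit]]]|[m2 _]]].
  (* Case (a): [C] has multiplicity zero and nothing to lose, so at most one is lost, through [u]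
     outside [C]. *)
  - set C := component e GA v in mC0.
    have vC : v \in C by apply: component_refl; rewrite inE.
    have sCGA : C \subset GA by apply/subsetP=> x; rewrite inE => /andP[].
    have YC : Y :\: C = (GA :\: C) :\ u.
      rewrite YE; apply/setP=> x; rewrite !in_setD !in_set1.
      by have [->|] := eqVneq x v; rewrite ?vC ?andbF //= andbCA.
    have := mult_component e_sym e_irr theta v (subxx GA).
    have := mult_component e_sym e_irr theta v sYGA.
    have := del (GA :\: C) u; rewrite -/C YC (setIidPr sCGA).
    by move: ess_pos mGA mC0; mult_lia.
  (* Case (b): both vertices lie in [C], which has multiplicity one by [gallai], so at most one is
     lost. *)
  - set C := component e GA u in vC crit.
    have uC : u \in C by apply: component_refl; rewrite inE.
    have sCGA : C \subset GA by apply/subsetP=> x; rewrite inE => /andP[].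
    have YC : Y :\: C = GA :\: C.
      rewrite YE; apply/setP=> x; rewrite !in_setD !in_set1.
      have [->|_] := eqVneq x v; first by rewrite vC.
      by have [->|_] := eqVneq x u; first by rewrite uC.
    have := mult_component e_sym e_irr theta u (subxx GA).
    have := mult_component e_sym e_irr theta u sYGA.
    rewrite -/C YC (setIidPr sCGA) (gallai e_sym e_irr crit).
    by move: ess_pos mGA; mult_lia.
  (* Case (c): two deletions lose at most two, which [m2] covers. *)
  have := del GA u; have := del (GA :\ u) v; rewrite -YE.
  by move: m2 mGA; mult_lia.
have S_sym : symmetric (Srel theta e).
  by move=> x y; rewrite /Srel /= e_sym (eq_sym x y) (orbC (x \in _)).
have S_irr : irreflexive (Srel theta e) by move=> x; rewrite /Srel /= e_irr eqxx.
have mY : mult theta (Srel theta e) Y = mult theta e Y.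
  apply: mult_eq_in => x y xY yY.
  have := (subsetP sYGA x xY, subsetP sYGA y yY).
  by rewrite /Srel /= !in_setC -/A => -[/negbTE-> /negbTE->]; rewrite andbF orbF.
have -> : ~: [set u; v] = A :|: Y.
  apply/setP => x; rewrite !(in_setU, in_setC, in_set1).
  have [->|_] := eqVneq x u; first by rewrite (negbTE uA).
  have [->|_] := eqVneq x v; first by rewrite (negbTE vA).
  by case: (x \in A).
apply: mult_join; rewrite // ?mY //.
  by apply/pred0P=> x; rewrite /= in_setC in_setU; case: (x \in A).
by move=> b z bA _ bz; rewrite /Srel /= bz -/A bA orbT.
Qed.
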